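(* (The first double fundamental theorem of calculus) Let $a,b\in\mathbb{R}^2$ with $a<b$. Suppose that $f:[a,b]\to\mathbb{R}$ is continuous. Define $G:[a,b]\to\mathbb{R}$ by $G(x)=\iint_{[a,x]} f(t)\,dt_1\,dt_2$ for $x\in[a,b]$. Then $G$ is double differentiable on $[a,b]$ with $G'=f$.
   Context: Points of $\mathbb{R}^2$ are written $a=(a_1,a_2)$. $a<b$ means $a_1<b_1$ and $a_2<b_2$; $a\le b$ means $a_1\le b_1$ and $a_2\le b_2$; $a\nsim b$ means $a_1\ne b_1$ and $a_2\ne b_2$. $[a,b]=\{x\in\mathbb{R}^2:a\le x\le b\}$. The integral is the Riemann double integral over the rectangle $[a,x]$ (equal to $0$ if $x_1=a_1$ or $x_2=a_2$). A double function is a real-valued function $g$ with domain $D(g)\subseteq\mathbb{R}^2$. The double difference is $\Delta_p^x(g)=g(x_1,x_2)-g(x_1,p_2)-g(p_1,x_2)+g(p_1,p_2)$, and for $p\nsim x$, $m_p^x(g)=\Delta_p^x(g)/((x_1-p_1)(x_2-p_2))$. $g$ is double differentiable at $p$ with double derivative $g'(p)\in\mathbb{R}$ if $D(g)$ contains a product of two open intervals containing $p$ and for every $\epsilon>0$ there are $\delta_1,\delta_2>0$ such that for all $x$ with $0<|x_1-p_1|<\delta_1$, $0<|x_2-p_2|<\delta_2$, $m_p^x(g)$ is defined and $|m_p^x(g)-g'(p)|<\epsilon$. For signs $\sigma,\tau\in\{+,-\}$, the $\sigma\tau$-double derivative $g'_{\sigma\tau}(p)$ is defined in the same way, but restricting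 to those $x$ for which $x_1-p_1$ has sign $\sigma$ and $x_2-p_2$ has sign $\tau$ (the domain being required to contain $p$ and all points $x$ with $|x_i-p_i|<\delta_i$, $i=1,2$, in the corresponding closed quadrant with vertex $p$, for some $\delta_1,\delta_2>0$). $g$ is double differentiable on $[a,b]$ with $g'=f$ if $g'(p)=f(p)$ at each interior point $p$ of $[a,b]$ and, at each boundary point $p$ of $[a,b]$, $g'_{\sigma\tau}(p)$ exists and equals $f(p)$ for every sign pair $\sigma\tau$ for which the corresponding closed quadrant with vertex $p$, intersected with some open rectangle centred at $p$, is contained in $[a,b]$. *)

(* Defs.v *)
(* Stdlib reals with Coquelicot. *)
From Stdlib Require Import Reals.
From Coquelicot Require Import Coquelicot.
Open Scope R_scope.

Definition lt2 (a b : R * R) : Prop := fst a < fst b /\ snd a < snd b.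

Definition le2 (a b : R * R) : Prop := fst a <= fst b /\ snd a <= snd b.

Definition nsim (a b : R * R) : Prop := fst a <> fst b /\ snd a <> snd b.

Definition rect (a b : R * R) : R * R -> Prop := fun x => le2 a x /\ le2 x b.

(** ** Riemann double integral *)

(* [x 0 <= x 1 <= ... <= x (S n)] cuts [a, b] into [S n] subintervals. *)
Definition subdivision (a b : R) (n : nat) (x : nat -> R) : Prop :=
  x 0%nat = a /\ x (S n) = b /\
  forall i : nat, (i <= n)%nat -> x i <= x (S i).

Definition mesh_lt (n : nat) (x : nat -> R) (delta : R) : Prop :=
  forall i : nat, (i <= n)%nat -> x (S i) - x i < delta.

(* One tag for each cell of the grid; the tags need not form a grid. *)
Definition tagging (n m : nat) (x y : nat -> R) (t : nat -> nat -> R * R)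
  : Prop :=
  forall i j : nat, (i <= n)%nat -> (j <= m)%nat ->
    rect (x i, y j) (x (S i), y (S j)) (t i j).

Definition Riemann_sum2 (f : R * R -> R) (n m : nat) (x y : nat -> R)
  (t : nat -> nat -> R * R) : R :=
  sum_f_R0 (fun i =>
    sum_f_R0 (fun j =>
      f (t i j) * ((x (S i) - x i) * (y (S j) - y j))) m) n.

(* The value is 0 when [fst a = fst b] or [snd a = snd b]: then all the cells
   have area 0. *)
Definition is_RInt2 (f : R * R -> R) (a b : R * R) (I : R) : Prop :=
  forall eps : R, 0 < eps -> exists delta : R, 0 < delta /\
    forall (n m : nat) (x y : nat -> R) (t : nat -> nat -> R * R),
      subdivision (fst a) (fst b) n x -> subdivision (snd a) (snd b) m y ->
      mesh_lt n x delta -> mesh_lt m y delta -> tagging n m x y t ->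
      Rabs (Riemann_sum2 f n m x y t - I) < eps.

(* Total operator, like Coquelicot's [RInt]: meaningful when an integral
   exists. *)
Definition RInt2 (f : R * R -> R) (a b : R * R) : R :=
  iota (fun I : R => is_RInt2 f a b I).

(** ** Double functions and double derivatives *)

(* A partial function on the plane; [dval] is irrelevant outside [dom]. *)
Record double_function : Type := DoubleFunction {
  dom : R * R -> Prop;
  dval :> R * R -> R
}.

Definition ddiff (g : double_function) (p x : R * R) : R :=
  g (fst x, snd x) - g (fst x, snd p) - g (fst p, snd x) + g (fst p, snd p).

Definition mslope (g : double_function) (p x : R * R) : R :=
  ddiff g p x / ((fst x - fst p) * (snd x - snd p)).

Definition mslope_defined (g : double_function) (p x : R * R) : Prop :=
  nsim p x /\
  dom g (fst x, snd x) /\ dom g (fst x, snd p) /\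
  dom g (fst p, snd x) /\ dom g (fst p, snd p).

Definition is_double_derive (g : double_function) (p : R * R) (l : R) : Prop :=
  (exists u v : R * R, lt2 u p /\ lt2 p v /\
     forall x : R * R, lt2 u x -> lt2 x v -> dom g x) /\
  forall eps : R, 0 < eps ->
    exists d1 d2 : R, 0 < d1 /\ 0 < d2 /\
      forall x : R * R,
        0 < Rabs (fst x - fst p) < d1 -> 0 < Rabs (snd x - snd p) < d2 ->
        mslope_defined g p x /\ Rabs (mslope g p x - l) < eps.

Inductive sgn : Type := Plus | Minus.

Definition has_sgn (s : sgn) (r : R) : Prop :=
  match s with Plus => 0 < r | Minus => r < 0 end.

Definition closed_quadrant (s t : sgn) (p : R * R) : R * R -> Prop :=
  fun x =>
    (fst x = fst p \/ has_sgn s (fst x - fst p)) /\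
    (snd x = snd p \/ has_sgn t (snd x - snd p)).

Definition quadrant_near_in (s t : sgn) (p : R * R) (D : R * R -> Prop)
  : Prop :=
  exists d1 d2 : R, 0 < d1 /\ 0 < d2 /\
    forall x : R * R, closed_quadrant s t p x ->
      Rabs (fst x - fst p) < d1 -> Rabs (snd x - snd p) < d2 -> D x.

Definition is_double_derive_sided (s t : sgn) (g : double_function)
  (p : R * R) (l : R) : Prop :=
  quadrant_near_in s t p (dom g) /\
  forall eps : R, 0 < eps ->
    exists d1 d2 : R, 0 < d1 /\ 0 < d2 /\
      forall x : R * R,
        0 < Rabs (fst x - fst p) < d1 -> 0 < Rabs (snd x - snd p) < d2 ->
        has_sgn s (fst x - fst p) -> has_sgn t (snd x - snd p) ->
        mslope_defined g p x /\ Rabs (mslope g p x - l) < eps.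

(* [locally p (rect a b)] says that [p] is an interior point of [rect a b]. *)
Definition double_differentiable_on (g : double_function) (a b : R * R)
  (f : R * R -> R) : Prop :=
  (forall p : R * R, locally p (rect a b) -> is_double_derive g p (f p)) /\
  (forall p : R * R, rect a b p -> ~ locally p (rect a b) ->
     forall s t : sgn, quadrant_near_in s t p (rect a b) ->
       is_double_derive_sided s t g p (f p)).

(* Main.v *)
(** A continuous [f] on the rectangle extends to the whole plane by clamping the
    coordinates, and for continuous integrands the Riemann double integral is
    the iterated one.  The iterated integral is additive in each pair of
    opposite sides, so the double difference of [G] between [p] and [x] is the
    iterated integral over the rectangle with opposite corners [p] and [x];
    as [f] differs from [f p] by at most [eps] there, the double difference
    differs from [f p] times the (signed) area by at most [eps] times the
    area. *)
Require Import Defs.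
From Stdlib Require Import Reals Lra Lia.
From Coquelicot Require Import Coquelicot.
Open Scope R_scope.

(** * Estimates for integrals over unordered intervals *)

(** Increments from [p] may be negative, so the endpoints come in either order; swapping them only
    changes the sign of the integral. *)
Lemma abs_RInt_le_const_unordered (g : R -> R) (c d M : R) :
  ex_RInt g c d ->
  (forall t : R, Rmin c d <= t <= Rmax c d -> Rabs (g t) <= M) ->
  Rabs (RInt g c d) <= M * Rabs (d - c).
Proof.
  intros Hg HM. destruct (Rle_dec c d) as [H | H].
  - rewrite Rmin_left, Rmax_right in HM by lra.
    rewrite (Rabs_pos_eq (d - c)), Rmult_comm by lra.
    now apply abs_RInt_le_const.
  - rewrite Rmin_right, Rmax_left in HM by lra.
    rewrite <- (opp_RInt_swap g d c) by now apply ex_RInt_swap.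
    change (opp (RInt g d c)) with (- RInt g d c).
    rewrite Rabs_Ropp, (Rabs_left1 (d - c)) by lra.
    replace (M * - (d - c)) with ((c - d) * M) by ring.
    apply abs_RInt_le_const; [lra | now apply ex_RInt_swap | exact HM].
Qed.

Lemma abs_RInt_minus_const_le (g : R -> R) (c d l M : R) :
  ex_RInt g c d ->
  (forall t : R, Rmin c d <= t <= Rmax c d -> Rabs (g t - l) <= M) ->
  Rabs (RInt g c d - l * (d - c)) <= M * Rabs (d - c).
Proof.
  intros Hg HM.
  replace (RInt g c d - l * (d - c)) with (RInt (fun t => g t - l) c d).
  - apply abs_RInt_le_const_unordered; [| exact HM].
    apply (ex_RInt_minus (V := R_NormedModule) g (fun _ => l)); trivial.
    apply ex_RInt_const.
  - pose proof (RInt_minus (V := R_CompleteNormedModule) g (fun _ => l) c d Hg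
      (ex_RInt_const c d l)) as E.
    rewrite RInt_const in E.
    change (RInt (fun t => g t - l) c d = RInt g c d - (d - c) * l) in E.
    rewrite E. apply (f_equal (Rminus _)), Rmult_comm.
Qed.

(** * Iterated integrals of continuous functions *)

(** Continuity on the whole plane makes every section integrable between any endpoints, so
    additivity carries no side conditions. *)
Definition continuous_2d (F : R -> R -> R) : Prop :=
  forall u v : R, continuity_2d_pt F u v.

Lemma continuous_2d_section (F : R -> R -> R) (u v : R) :
  continuous_2d F -> continuous (F u) v.
Proof.
  intros HF. apply filterlim_locally. intros eps.
  destruct (HF u v eps) as [d Hd].
  exists d. intros w Hw. apply Hd; [| exact Hw].
  rewrite Rminus_diag, Rabs_R0. apply cond_pos.
Qed.

Lemma ex_RInt_section (F : R -> R -> R) (u c d : R) :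
  continuous_2d F -> ex_RInt (F u) c d.
Proof.
  intros HF. apply (ex_RInt_continuous (V := R_CompleteNormedModule)).
  intros z _. now apply continuous_2d_section.
Qed.

(** By uniform continuity on a compact strip around [x], the integrands at [u] and [x] are uniformly
    close. *)
Lemma continuous_RInt_param (F : R -> R -> R) (c d x : R) :
  continuous_2d F -> continuous (fun u => RInt (F u) c d) x.
Proof.
  intros HF. apply filterlim_locally. intros eps.
  (* The summand 1 avoids division by zero when [c = d], and makes the final inequality strict. *)
  assert (He : 0 < eps / (Rabs (d - c) + 1)).
  { apply Rdiv_lt_0_compat; [apply cond_pos |].
    pose proof (Rabs_pos (d - c)); lra. }
  destruct (uniform_continuity_2d F (x - 1) (x + 1) (Rmin c d) (Rmax c d)
    (fun u v _ _ => HF u v) (mkposreal _ He)) as [del Hdel].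
  assert (Hm : 0 < Rmin 1 del) by (apply Rmin_pos; [lra | apply cond_pos]).
  exists (mkposreal _ Hm). intros u Hu.
  change (Rabs (u - x) < Rmin 1 del) in Hu.
  change (Rabs (RInt (F u) c d - RInt (F x) c d) < eps).
  pose proof (RInt_minus (V := R_CompleteNormedModule) (F u) (F x) c d
    (ex_RInt_section F u c d HF) (ex_RInt_section F x c d HF)) as E.
  change (RInt (fun t => F u t - F x t) c d
          = RInt (F u) c d - RInt (F x) c d) in E.
  rewrite <- E.
  apply Rle_lt_trans with (eps / (Rabs (d - c) + 1) * Rabs (d - c)).
  - apply abs_RInt_le_const_unordered.
    + apply (ex_RInt_minus (V := R_NormedModule)); now apply ex_RInt_section.
    + intros t Ht. apply Rlt_le.
      pose proof (Rmin_l 1 del). pose proof (Rmin_r 1 del).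
      assert (Hu1 : Rabs (u - x) < 1) by lra. apply Rabs_def2 in Hu1.
      apply Hdel; try lra.
      rewrite Rminus_diag, Rabs_R0. apply cond_pos.
  - pose proof (Rabs_pos (d - c)). pose proof (cond_pos eps).
    apply Rlt_le_trans with (eps / (Rabs (d - c) + 1) * (Rabs (d - c) + 1)).
    + apply Rmult_lt_compat_l; lra.
    + right. field. lra.
Qed.

(** The corners may be in any position: the integral is oriented in each variable. *)
Definition iter_RInt (F : R -> R -> R) (p q : R * R) : R :=
  RInt (fun u => RInt (F u) (snd p) (snd q)) (fst p) (fst q).

Section IteratedIntegral.

Variable F : R -> R -> R.
Hypothesis HF : continuous_2d F.

Lemma ex_RInt_RInt_param (c d u v : R) :
  ex_RInt (fun s => RInt (F s) c d) u v.
Proof.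
  apply (ex_RInt_continuous (V := R_CompleteNormedModule)).
  intros z _. now apply continuous_RInt_param.
Qed.

Lemma iter_RInt_Chasles_fst (c d u v w : R) :
  iter_RInt F (u, c) (v, d) + iter_RInt F (v, c) (w, d)
  = iter_RInt F (u, c) (w, d).
Proof.
  exact (RInt_Chasles _ u v w
    (ex_RInt_RInt_param c d u v) (ex_RInt_RInt_param c d v w)).
Qed.

(** Additivity of the inner integral, integrated over the outer variable by linearity. *)
Lemma iter_RInt_Chasles_snd (c d u v w : R) :
  iter_RInt F (c, u) (d, v) + iter_RInt F (c, v) (d, w)
  = iter_RInt F (c, u) (d, w).
Proof.
  unfold iter_RInt; simpl.
  pose proof (RInt_plus (V := R_CompleteNormedModule) _ _ c d
    (ex_RInt_RInt_param u v c d) (ex_RInt_RInt_param v w c d)) as E.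
  etransitivity; [symmetry; exact E |].
  apply RInt_ext. intros s _.
  apply (RInt_Chasles (V := R_CompleteNormedModule)); now apply ex_RInt_section.
Qed.

(** Additivity in the first variable, at heights [q2] and [p2], leaves two rectangles over [p1],
    [q1] with base [a2]; additivity in the second variable subtracts one from the other. *)
Lemma iter_RInt_ddiff (a p q : R * R) :
  iter_RInt F a (fst q, snd q) - iter_RInt F a (fst q, snd p)
  - iter_RInt F a (fst p, snd q) + iter_RInt F a (fst p, snd p)
  = iter_RInt F p q.
Proof.
  destruct a as [a1 a2], p as [p1 p2], q as [q1 q2]; simpl.
  pose proof (iter_RInt_Chasles_fst a2 q2 a1 p1 q1).
  pose proof (iter_RInt_Chasles_fst a2 p2 a1 p1 q1).
  pose proof (iter_RInt_Chasles_snd p1 q1 a2 p2 q2).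
  lra.
Qed.

(** The one-variable estimate is used twice: inside with constant [l], then outside with constant
    [l * (snd q - snd p)] and error [M * Rabs (snd q - snd p)]. *)
Lemma iter_RInt_near_const (p q : R * R) (l M : R) :
  (forall u v : R, Rmin (fst p) (fst q) <= u <= Rmax (fst p) (fst q) ->
     Rmin (snd p) (snd q) <= v <= Rmax (snd p) (snd q) ->
     Rabs (F u v - l) <= M) ->
  Rabs (iter_RInt F p q - l * ((fst q - fst p) * (snd q - snd p)))
  <= M * Rabs ((fst q - fst p) * (snd q - snd p)).
Proof.
  intros H. rewrite Rabs_mult.
  replace (l * ((fst q - fst p) * (snd q - snd p)))
    with (l * (snd q - snd p) * (fst q - fst p)) by ring.
  replace (M * (Rabs (fst q - fst p) * Rabs (snd q - snd p)))
    with (M * Rabs (snd q - snd p) * Rabs (fst q - fst p)) by ring.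
  apply abs_RInt_minus_const_le; [apply ex_RInt_RInt_param |].
  intros u Hu. apply abs_RInt_minus_const_le; [now apply ex_RInt_section |].
  intros v Hv. now apply H.
Qed.

End IteratedIntegral.

(** * The Riemann double integral as an iterated integral *)

Lemma sum_Chasles (K : R -> R -> R) (x : nat -> R) (n : nat) :
  (forall u v w : R, K u v + K v w = K u w) ->
  sum_f_R0 (fun i => K (x i) (x (S i))) n = K (x 0%nat) (x (S n)).
Proof.
  intros HK. induction n as [| n IH]; [reflexivity |].
  rewrite tech5, IH. apply HK.
Qed.

Lemma subdivision_bounds (a b : R) (n : nat) (x : nat -> R) (i : nat) :
  Defs.subdivision a b n x -> (i <= S n)%nat -> a <= x i <= b.
Proof.
  intros (H0 & H1 & Hx) Hi. split.
  - induction i as [| i IH]; [lra |].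
    specialize (Hx i ltac:(lia)). specialize (IH ltac:(lia)). lra.
  (* The upper bound is proved by descending from the last point [x (S n)]. *)
  - assert (H : forall k, (k <= S n)%nat -> x (S n - k)%nat <= b).
    { induction k as [| k IH]; intros Hk.
      - rewrite Nat.sub_0_r. lra.
      - specialize (Hx (S n - S k)%nat ltac:(lia)).
        replace (S (S n - S k)) with (S n - k)%nat in Hx by lia.
        specialize (IH ltac:(lia)). lra. }
    specialize (H (S n - i)%nat ltac:(lia)).
    now replace (S n - (S n - i))%nat with i in H by lia.
Qed.

Lemma fine_subdivision_exists (a b delta : R) :
  a <= b -> 0 < delta ->
  exists (n : nat) (x : nat -> R), Defs.subdivision a b n x /\ mesh_lt n x delta.
Proof.
  intros Hab Hd.
  destruct (INR_unbounded ((b - a) / delta)) as [n Hn].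
  pose proof (pos_INR n) as Hn0.
  assert (HS : INR (S n) = INR n + 1) by apply S_INR.
  (* Equal pieces of length [(b - a) / (n + 1)], which is below [delta] by the choice of [n]. *)
  exists n, (fun i => a + INR i * ((b - a) / INR (S n))).
  assert (Hstep : forall i, a + INR (S i) * ((b - a) / INR (S n))
    - (a + INR i * ((b - a) / INR (S n))) = (b - a) / INR (S n)).
  { intros i. rewrite (S_INR i). ring. }
  assert (H0 : 0 <= (b - a) / INR (S n)).
  { apply Rdiv_le_0_compat; lra. }
  split.
  - split; [simpl; ring |]. split; [field; lra |].
    intros i _. specialize (Hstep i). lra.
  - intros i _. rewrite Hstep.
    apply Rlt_div_l; [lra |].
    apply Rlt_div_l in Hn; [| lra]. rewrite HS. nra.
Qed.

(** One tagged grid fine enough for both integrals puts [I] and [J] within [eps / 2] of the same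
    sum. For unordered corners there is no subdivision, and every number would be an integral. *)
Lemma is_RInt2_unique (f : R * R -> R) (a b : R * R) (I J : R) :
  le2 a b -> is_RInt2 f a b I -> is_RInt2 f a b J -> I = J.
Proof.
  intros [Hab1 Hab2] HI HJ. apply Req_lt_aux. intros eps.
  destruct (HI (eps / 2)) as (d & Hd & Hi); [apply is_pos_div_2 |].
  destruct (HJ (eps / 2)) as (e & He & Hj); [apply is_pos_div_2 |].
  assert (Hm : 0 < Rmin d e) by now apply Rmin_pos.
  destruct (fine_subdivision_exists _ _ _ Hab1 Hm) as (n & x & Hx & Hmx).
  destruct (fine_subdivision_exists _ _ _ Hab2 Hm) as (m & y & Hy & Hmy).
  assert (Ht : tagging n m x y (fun i j => (x i, y j))).
  { intros i j Hin Hjm. destruct Hx as (_ & _ & Hx), Hy as (_ & _ & Hy).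
    specialize (Hx i Hin). specialize (Hy j Hjm).
    repeat split; simpl; lra. }
  pose proof (Rmin_l d e). pose proof (Rmin_r d e).
  specialize (Hi n m x y _ Hx Hy
    ltac:(intros i Hi'; specialize (Hmx i Hi'); lra)
    ltac:(intros i Hi'; specialize (Hmy i Hi'); lra) Ht).
  specialize (Hj n m x y _ Hx Hy
    ltac:(intros i Hi'; specialize (Hmx i Hi'); lra)
    ltac:(intros i Hi'; specialize (Hmy i Hi'); lra) Ht).
  apply Rabs_def2 in Hi. apply Rabs_def2 in Hj. apply Rabs_def1; lra.
Qed.

Lemma RInt2_correct_unique (f : R * R -> R) (a b : R * R) (I : R) :
  le2 a b -> is_RInt2 f a b I -> RInt2 f a b = I.
Proof.
  intros Hab HI.
  apply (iota_unique (V := R_CompleteNormedModule)); [| exact HI].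
  intros J HJ. exact (is_RInt2_unique f a b J I Hab HJ HI).
Qed.

(** On each cell the integral is within [M] times the area of the corresponding term; these bounds
    add up over the grid. *)
Lemma Riemann_sum2_near_iter_RInt (F : R -> R -> R) (f : R * R -> R)
  (a b : R * R) (n m : nat) (x y : nat -> R) (t : nat -> nat -> R * R)
  (M : R) :
  continuous_2d F ->
  Defs.subdivision (fst a) (fst b) n x -> Defs.subdivision (snd a) (snd b) m y ->
  (forall i j u v, (i <= n)%nat -> (j <= m)%nat ->
     x i <= u <= x (S i) -> y j <= v <= y (S j) ->
     Rabs (F u v - f (t i j)) <= M) ->
  Rabs (Riemann_sum2 f n m x y t - iter_RInt F a b)
  <= M * ((fst b - fst a) * (snd b - snd a)).
Proof.
  intros HF Hx Hy HM.
  (* A rectangle function additive in both directions sums over the cells to its value on the whole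
     rectangle. It serves for the iterated integral and for [M] times the area. *)
  assert (Hadd : forall K : R * R -> R * R -> R,
    (forall c d u v w, K (u, c) (v, d) + K (v, c) (w, d) = K (u, c) (w, d)) ->
    (forall c d u v w, K (c, u) (d, v) + K (c, v) (d, w) = K (c, u) (d, w)) ->
    sum_f_R0 (fun i => sum_f_R0 (fun j =>
      K (x i, y j) (x (S i), y (S j))) m) n
    = K a b).
  { intros K H1 H2. rewrite (surjective_pairing a), (surjective_pairing b).
    destruct Hx as (<- & <- & _), Hy as (<- & <- & _).
    rewrite <- (sum_Chasles (fun u v => K (u, y 0%nat) (v, y (S m))) x n)
      by (intros; apply H1).
    apply sum_eq. intros i _.
    apply (sum_Chasles (fun u v => K (x i, u) (x (S i), v))).
    intros; apply H2. }
  rewrite <- (Hadd (iter_RInt F)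
    ltac:(intros; now apply iter_RInt_Chasles_fst)
    ltac:(intros; now apply iter_RInt_Chasles_snd)).
  rewrite <- (Hadd (fun p q => M * ((fst q - fst p) * (snd q - snd p)))
    ltac:(intros; simpl; ring) ltac:(intros; simpl; ring)).
  unfold Riemann_sum2. rewrite <- minus_sum.
  eapply Rle_trans; [apply Rsum_abs |].
  apply sum_Rle. intros i Hi. rewrite <- minus_sum.
  eapply Rle_trans; [apply Rsum_abs |].
  apply sum_Rle. intros j Hj.
  destruct Hx as (_ & _ & Hx), Hy as (_ & _ & Hy).
  specialize (Hx i Hi). specialize (Hy j Hj).
  rewrite Rabs_minus_sym.
  pose proof (iter_RInt_near_const F HF (x i, y j) (x (S i), y (S j))
    (f (t i j)) M) as H; simpl in H |- *.
  rewrite Rmin_left, Rmax_right, Rmin_left, Rmax_right,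
    (Rabs_pos_eq ((_ - _) * _)) in H by (try apply Rmult_le_pos; lra).
  apply H. intros u v Hu Hv. now apply HM.
Qed.

(** Uniform continuity gives a mesh for which [F] on each cell stays within [eps / (A + 1)] of its
    value at the tag. *)
Lemma is_RInt2_iter_RInt (F : R -> R -> R) (f : R * R -> R) (a b : R * R) :
  continuous_2d F -> le2 a b ->
  (forall z : R * R, rect a b z -> f z = F (fst z) (snd z)) ->
  is_RInt2 f a b (iter_RInt F a b).
Proof.
  intros HF [Hab1 Hab2] Hf eps Heps.
  set (A := (fst b - fst a) * (snd b - snd a)).
  assert (HA : 0 <= A) by (apply Rmult_le_pos; lra).
  assert (He : 0 < eps / (A + 1)) by (apply Rdiv_lt_0_compat; lra).
  destruct (uniform_continuity_2d F (fst a) (fst b) (snd a) (snd b)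
    (fun u v _ _ => HF u v) (mkposreal _ He)) as [del Hdel].
  exists del. split; [apply cond_pos |].
  intros n m x y t Hx Hy Hmx Hmy Ht.
  apply Rle_lt_trans with (eps / (A + 1) * A).
  - apply Riemann_sum2_near_iter_RInt; trivial.
    intros i j u v Hi Hj Hu Hv.
    destruct (Ht i j Hi Hj) as [[Ht1 Ht2] [Ht3 Ht4]]; simpl in *.
    pose proof (subdivision_bounds _ _ _ _ i Hx ltac:(lia)).
    pose proof (subdivision_bounds _ _ _ _ (S i) Hx ltac:(lia)).
    pose proof (subdivision_bounds _ _ _ _ j Hy ltac:(lia)).
    pose proof (subdivision_bounds _ _ _ _ (S j) Hy ltac:(lia)).
    specialize (Hmx i Hi). specialize (Hmy j Hj).
    rewrite Hf by (split; split; lra).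
    apply Rlt_le, Hdel; try lra; apply Rabs_def1; lra.
  - apply Rlt_le_trans with (eps / (A + 1) * (A + 1)).
    + apply Rmult_lt_compat_l; lra.
    + right. field. lra.
Qed.

(** * Continuous extension by clamping *)

Definition clamp (a b x : R) : R := Rmax a (Rmin b x).

Lemma clamp_bounds (a b x : R) : a <= b -> a <= clamp a b x <= b.
Proof.
  intros. unfold clamp, Rmax, Rmin. repeat destruct Rle_dec; lra.
Qed.

Lemma clamp_id (a b x : R) : a <= x <= b -> clamp a b x = x.
Proof.
  intros. unfold clamp, Rmax, Rmin. repeat destruct Rle_dec; lra.
Qed.

Lemma clamp_contract (a b x y : R) :
  Rabs (clamp a b x - clamp a b y) <= Rabs (x - y).
Proof.
  unfold clamp, Rmax, Rmin. repeat destruct Rle_dec;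
    unfold Rabs; repeat destruct Rcase_abs; lra.
Qed.

(** Clamped points stay in the rectangle and clamping is 1-Lipschitz, so the radius [d] valid for
    [f] at the clamped point also serves for the extension. *)
Lemma continuous_2d_clamp (a b : R * R) (f : R * R -> R) :
  le2 a b -> continuous_on (rect a b) f ->
  continuous_2d (fun u v =>
    f (clamp (fst a) (fst b) u, clamp (snd a) (snd b) v)).
Proof.
  intros [Hab1 Hab2] Hf u v eps.
  assert (Hr : forall s w,
    rect a b (clamp (fst a) (fst b) s, clamp (snd a) (snd b) w)).
  { intros s w. pose proof (clamp_bounds (fst a) (fst b) s Hab1).
    pose proof (clamp_bounds (snd a) (snd b) w Hab2).
    split; split; simpl; lra. }
  destruct (proj1 (filterlim_locally _ _) (Hf _ (Hr u v)) eps) as [d Hd].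
  exists d. intros s w Hs Hw. apply Hd; [| apply Hr].
  split; (eapply Rle_lt_trans; [apply clamp_contract | assumption]).
Qed.

(* Interior and boundary points, and all four quadrants, are treated at once:
   only the increments staying in the rectangle matter. *)
Lemma mslope_RInt2_near (a b : R * R) (f : R * R -> R) (p : R * R) (eps : R) :
  continuous_on (rect a b) f -> rect a b p -> 0 < eps ->
  let G := DoubleFunction (rect a b) (fun x : R * R => RInt2 f a x) in
  exists d : R, 0 < d /\
    forall x : R * R, rect a b x -> nsim p x ->
      Rabs (fst x - fst p) < d -> Rabs (snd x - snd p) < d ->
      mslope_defined G p x /\ Rabs (mslope G p x - f p) < eps.
Proof.
  intros Hf Hp Heps G. pose proof Hp as [[Hp1 Hp2] [Hp3 Hp4]].
  set (F := fun u v => f (clamp (fst a) (fst b) u, clamp (snd a) (snd b) v)).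
  assert (HF : continuous_2d F)
    by (apply continuous_2d_clamp; [split; lra | exact Hf]).
  assert (HFf : forall z, rect a b z -> f z = F (fst z) (snd z)).
  { intros [z1 z2] [[H1 H2] [H3 H4]]. unfold F; simpl in *.
    now rewrite !clamp_id. }
  (* For [z] in the rectangle, [a] and [z] are ordered and [f] agrees with [F] on all of
     [rect a z]. *)
  assert (HG : forall z, rect a b z -> G z = iter_RInt F a z).
  { intros z [Hz1 Hz2]. apply RInt2_correct_unique; [exact Hz1 |].
    apply is_RInt2_iter_RInt; trivial.
    intros w [Hw1 [Hw2 Hw3]]. apply HFf. split; [exact Hw1 |].
    destruct Hz2. split; lra. }
  assert (He2 : 0 < eps / 2) by lra.
  (* Half of [eps] is used because the integral estimate is not strict. *)
  destruct (HF (fst p) (snd p) (mkposreal _ He2)) as [d Hd].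
  exists d. split; [apply cond_pos |].
  intros x Hx [Hn1 Hn2] Hx1 Hx2. pose proof Hx as [[Ha1 Ha2] [Hb1 Hb2]].
  assert (Hc : rect a b (fst x, snd x) /\ rect a b (fst x, snd p) /\
               rect a b (fst p, snd x) /\ rect a b (fst p, snd p))
    by (repeat split; simpl; lra).
  split; [split; [split; trivial | exact Hc] |].
  destruct Hc as (Hc1 & Hc2 & Hc3 & Hc4).
  unfold mslope, ddiff. rewrite !HG by trivial.
  rewrite iter_RInt_ddiff by exact HF.
  set (A := (fst x - fst p) * (snd x - snd p)).
  assert (HA : A <> 0) by (apply Rmult_integral_contrapositive_currified; lra).
  pose proof (Rabs_pos_lt A HA) as HA0.
  replace (iter_RInt F p x / A - f p)
    with ((iter_RInt F p x - f p * A) / A) by (field; exact HA).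
  rewrite Rabs_div by exact HA. apply Rlt_div_l; [exact HA0 |].
  apply Rle_lt_trans with (eps / 2 * Rabs A).
  - apply iter_RInt_near_const; [exact HF |].
    (* [u] and [v] lie between the coordinates of [p] and [x], hence within [d] of those of [p]. *)
    intros u v Hu Hv. rewrite (HFf p Hp). apply Rlt_le.
    apply Rabs_def2 in Hx1. apply Rabs_def2 in Hx2.
    revert Hu Hv. unfold Rmin, Rmax.
    intros Hu Hv. apply Hd; apply Rabs_def1;
      repeat destruct Rle_dec; lra.
  - apply Rmult_lt_compat_r; lra.
Qed.

Theorem proposition36 (a b : R * R) (f : R * R -> R) :
  lt2 a b ->
  continuous_on (rect a b) f ->
  let G := DoubleFunction (rect a b) (fun x : R * R => RInt2 f a x) in
  double_differentiable_on G a b f.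
Proof.
  intros _ Hf G. split.
  - intros p Hp. pose proof (locally_singleton _ _ Hp) as Hpr.
    destruct Hp as [r Hr]. pose proof (cond_pos r) as Hr0.
    (* Balls of the product uniform structure are open squares, so an interior point has a square
       around it inside the rectangle. *)
    assert (Hball : forall x : R * R, Rabs (fst x - fst p) < r ->
      Rabs (snd x - snd p) < r -> rect a b x).
    { intros x H1 H2. apply Hr. now split. }
    split.
    + exists (fst p - r, snd p - r), (fst p + r, snd p + r).
      split; [split; simpl; lra |]. split; [split; simpl; lra |].
      intros x [H1 H2] [H3 H4]; simpl in *.
      apply Hball; apply Rabs_def1; lra.
    + intros eps Heps.
      destruct (mslope_RInt2_near a b f p eps Hf Hpr Heps) as (d & Hd & H).
      assert (Hm : 0 < Rmin d r) by now apply Rmin_pos.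
      pose proof (Rmin_l d r). pose proof (Rmin_r d r).
      exists (Rmin d r), (Rmin d r). repeat (split; [exact Hm |]).
      intros x [Hx1 Hx2] [Hy1 Hy2]. apply H; try lra.
      * apply Hball; lra.
      * split; intros E; rewrite E, Rminus_diag, Rabs_R0 in *; lra.
  (* Since [dom G] is [rect a b], the domain condition is the quadrant assumption itself; its radii
     then keep [x] in the rectangle. *)
  - intros p Hpr _ s t Hq. split; [exact Hq |].
    intros eps Heps. destruct Hq as (d1 & d2 & Hd1 & Hd2 & Hq).
    destruct (mslope_RInt2_near a b f p eps Hf Hpr Heps) as (d & Hd & H).
    pose proof (Rmin_l d d1). pose proof (Rmin_r d d1).
    pose proof (Rmin_l d d2). pose proof (Rmin_r d d2).
    exists (Rmin d d1), (Rmin d d2).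
    split; [now apply Rmin_pos |]. split; [now apply Rmin_pos |].
    intros x [Hx1 Hx2] [Hy1 Hy2] Hs Ht. apply H; try lra.
    + apply Hq; try lra. split; now right.
    + split; intros E; rewrite E, Rminus_diag, Rabs_R0 in *; lra.
Qed.
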